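(* Let $(\mathcal{S}_n)_{n\ge0}$ be the sequence of monic orthogonal polynomials associated with the bilinear form $$[p,q]_2=\int_{-\infty}^\infty\frac{p(x)q(x)-(pq)(0)-(pq)'(0)\,x}{x^2}\,e^{-x^2}dx-2\sqrt{\pi}\,p(0)q(0)+A\,p'(0)q'(0)$$ on polynomials, where $A$ is a constant, so that $\mathcal{S}_n(x)=H_n(x)+\lambda_nH_{n-2}(x)$ with $$\lambda_n=\begin{cases} m, & n=2m,\\[4pt] \dfrac{2\pi\,\Gamma(m+1)+\Gamma(m+3/2)\,A}{2\pi\,\Gamma(m)+\Gamma(m+1/2)\,A}, & n=2m+1,\end{cases}\qquad m\ge1.$$ Then $(\mathcal{S}_n)_{n\ge0}$ satisfies the five-term recurrence relation $$x^2\mathcal{S}_n(x)=\mathcal{S}_{n+2}(x)+b_n\mathcal{S}_n(x)+a_n\mathcal{S}_{n-2}(x),\qquad \mathcal{S}_{-2}(x)=\mathcal{S}_{-1}(x)=0,\quad \mathcal{S}_0(x)=1,$$ where $$b_n=\lambda_n+\frac{n(n-1)}{4\lambda_n}\ (n\ge2),\qquad a_n=\frac{(n-2)(n-3)}{4}\,\frac{\lambda_n}{\lambda_{n-2}}\ (n\ge4),$$ and $$b_0=-\tfrac12,\qquad b_1=\frac{\sqrt\pi}{2(\sqrt\pi+A)},\qquad a_2=-\tfrac12,\qquad a_3=\frac{\sqrt\pi}{2(\sqrt\pi+A)}.$$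
   Context: $H_n$ are the monic Hermite polynomials (orthogonal with respect to $e^{-x^2}dx$ on $\mathbb{R}$), with $xH_n=H_{n+1}+\frac n2H_{n-1}$, $H_0=1$, $H_1=x$. A sequence of monic orthogonal polynomials for a bilinear form $[\cdot,\cdot]$ is a sequence of monic polynomials $(\mathcal{S}_n)_{n\ge0}$ with $\deg\mathcal{S}_n=n$ and $[\mathcal{S}_n,\mathcal{S}_k]=K_n\delta_{n,k}$, $K_n\neq0$. The form above satisfies $[x^2p,q]_2=[p,x^2q]_2=\int_{-\infty}^\infty p(x)q(x)e^{-x^2}dx$, with $[1,1]_2=-2\sqrt\pi$, $[1,x]_2=[x,1]_2=0$ and $[x,x]_2=\sqrt\pi+A$. $\Gamma$ is the Gamma function.
   Formalization: For A≠0 the printed λ_n (n odd) and a_3 contradict the form; proved instead: λ_{2m+1} with 4A in place of A, and a_3=λ_3√π/(2(√π+A)), the connection formula being a conclusion. The printed version is proved only with its connection formula as a hypothesis, which forces A=0. *)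

(* Defs.v *)
From HB Require Import structures.
From mathcomp Require Export all_boot all_order all_algebra.
From mathcomp Require Export all_classical all_reals all_analysis.

Set Implicit Arguments.
Unset Strict Implicit.
Unset Printing Implicit Defensive.

Import Order.TTheory GRing.Theory Num.Theory.
Import numFieldNormedType.Exports.

Local Open Scope classical_set_scope.
Local Open Scope ring_scope.

Definition Gamma (R : realType) (s : R) : R :=
  Rintegral lebesgue_measure `[0, +oo[ (fun t : R => t `^ (s - 1) * expR (- t)).

Fixpoint hermite (R : realType) (n : nat) : {poly R} :=
  match n with
  | 0 => 1
  | 1 => 'X
  | (n'.+1 as n1).+1 =>
      'X * hermite R n1 - (n1%:R / 2) *: hermite R n'
  end.

(* The integrand is a polynomial times a Gaussian away from 0; its value at 0
   (here 0, as _ / 0 = 0) does not affect the integral. *)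
Definition form2 (R : realType) (A : R) (p q : {poly R}) : R :=
  Rintegral lebesgue_measure setT (fun x : R =>
    ((p.[x] * q.[x] - (p * q).[0] - ((p * q)^`()).[0] * x) / x ^+ 2)
    * expR (- x ^+ 2))
  - 2 * Num.sqrt pi * (p.[0] * q.[0])
  + A * (p^`().[0] * q^`().[0]).

Definition monic_orthogonal (R : realType) (B : {poly R} -> {poly R} -> R)
    (S : nat -> {poly R}) : Prop :=
  (forall n, S n \is monic /\ size (S n) = n.+1) /\
  exists K : nat -> R,
    (forall n, K n != 0) /\ forall n k, B (S n) (S k) = K n * (n == k)%:R.

(* Only meaningful for n >= 2.  Orthogonality of S_(2m+1) to x for [form2 A]
   forces lambda_(2m+1) = - I_m / I_(m-1), where
     I_m = [H_(2m+1), x]_2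
         = (-1)^m (sqrt pi * Gamma(m+1) + 2 A Gamma(m+3/2) / sqrt pi);
   this is the formula below evaluated at 4 * A, not at A. *)
Definition lambda (R : realType) (A : R) (n : nat) : R :=
  let m : R := (n./2)%:R in
  if odd n then
    (2 * pi * Gamma (m + 1) + Gamma (m + 3 / 2) * A)
    / (2 * pi * Gamma m + Gamma (m + 1 / 2) * A)
  else m.

Definition hermite_connection (R : realType) (S : nat -> {poly R})
    (lam : nat -> R) : Prop :=
  forall n, (2 <= n)%N -> S n = hermite R n + lam n *: hermite R (n - 2).

Definition coef_b (R : realType) (A : R) (lam : nat -> R) (n : nat) : R :=
  match n with
  | 0 => - (1 / 2)
  | 1 => Num.sqrt pi / (2 * (Num.sqrt pi + A))
  | _ => lam n + (n * (n - 1))%:R / (4 * lam n)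
  end.

(* The values at n = 0, 1 are junk: they multiply S_(-2) = S_(-1) = 0. *)
Definition coef_a (R : realType) (a3 : R) (lam : nat -> R) (n : nat) : R :=
  match n with
  | 0 | 1 => 0
  | 2 => - (1 / 2)
  | 3 => a3
  | _ => ((n - 2) * (n - 3))%:R / 4 * (lam n / lam (n - 2)%N)
  end.

Definition extend0 (R : realType) (S : nat -> {poly R}) (k : int) : {poly R} :=
  match k with
  | Posz n => S n
  | Negz _ => 0
  end.

Definition five_term_recurrence (R : realType) (S : nat -> {poly R})
    (b a : nat -> R) : Prop :=
  S 0%N = 1 /\
  forall n : nat,
    'X^2 * S n = S n.+2 + b n *: S n + a n *: extend0 S (n%:Z - 2).

(* Main.v *)
Require Import Defs.
From mathcomp Require Import measurable_realfun ring lra.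

(* The form satisfies [x^2 p, q] = L(pq) with L(f) the integral of f e^{-x^2}.
   Applying it to the five-term recurrence of H_n yields a recurrence for
   [H_n, 1] and [H_n, x], which shows that T_n = H_n + lambda_n H_(n-2) is
   orthogonal to 1 and x as soon as
     lambda_(n+2) = n + 1/2 - n (n-1) / (4 lambda_n);
   orthogonality to x^2 r, with deg r < n - 2, is that of the Hermite
   polynomials.  As the existence of S makes the form nondegenerate on each
   space of polynomials of bounded degree, S_n = T_n, and no denominator of
   lambda vanishes: otherwise H_(2m+1) would be orthogonal to all polynomials of
   degree at most 2m+1.  The recurrence for S_n is then a comparison of Hermite
   coefficients.  The printed connection formula agrees with this one only for
   A = 0, where the printed constants coincide with the repaired ones. *)

Set Implicit Arguments.
Unset Strict Implicit.
Unset Printing Implicit Defensive.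

Import Order.TTheory GRing.Theory Num.Theory.
Import numFieldNormedType.Exports.
Local Open Scope classical_set_scope.
Local Open Scope ring_scope.

(** * Integrals of polynomials against the Gaussian weight *)

(** For [|x| <= 1] the summand 1 of the constant suffices; beyond, [|x|^k <= |x|^(2k+2)], which one
    term of the exponential series at [x^2/2] controls. Against the weight [e^(-x^2)] this bound
    leaves the integrable factor [e^(-x^2/2)]. *)
Lemma exprn_le_expR (R : realType) (k : nat) :
  exists2 C : R, 0 <= C & forall x : R, `|x| ^+ k <= C * expR (x ^+ 2 / 2).
Proof.
exists (1 + 2 ^+ k.+1 * k.+1`!%:R); first by rewrite addr_ge0// mulr_ge0.
move=> x; set y := x ^+ 2 / 2.
have y0 : 0 <= y by rewrite divr_ge0// sqr_ge0.
have e1 : 1 <= expR y by rewrite -expR0 ler_expR.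
have e2 : (x ^+ 2) ^+ k.+1 <= 2 ^+ k.+1 * k.+1`!%:R * expR y.
  have /(le_trans _) := expR_ge1Dxn k y0.
  move=> /(_ (y ^+ k.+1 / k.+1`!%:R)); rewrite lerDr ler01 => /(_ isT).
  rewrite ler_pdivrMr ?ltr0n ?fact_gt0// /y expr_div_n ler_pdivrMr ?exprn_gt0//.
  by move=> /le_trans; apply; rewrite le_eqVlt; apply/orP; left; apply/eqP; ring.
rewrite mulrDl mul1r; have [x1|x1] := lerP `|x| 1.
  rewrite (le_trans (exprn_ile1 _ _ _))// (le_trans e1)// lerDl.
  by rewrite !mulr_ge0// ltW// expR_gt0.
rewrite -(real_normK (num_real x)) -exprM in e2.
rewrite (@le_trans _ _ (`|x| ^+ (2 * k.+1)))//.
  by rewrite ler_weXn2l ?(ltW x1)// (leq_trans (leqnSn k))// leq_pmull.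
by rewrite (le_trans e2)// lerDr (le_trans _ e1).
Qed.

Lemma horner_le_expR (R : realType) (p : {poly R}) :
  exists2 C : R, 0 <= C & forall x : R, `|p.[x]| <= C * expR (x ^+ 2 / 2).
Proof.
(* The extra factor [x^k] lets the induction on [p * 'X + c] absorb ['X] into [x^(k+1)]. *)
suff /(_ 0%N)[C C0 h] : forall k, exists2 C : R, 0 <= C &
    forall x, `|x ^+ k * p.[x]| <= C * expR (x ^+ 2 / 2).
  by exists C => // x; have := h x; rewrite mul1r.
elim/poly_ind: p => [|p c IH] k.
  by exists 0 => // x; rewrite horner0 mulr0 normr0 mul0r.
have [C C0 hC] := IH k.+1; have [D D0 hD] := @exprn_le_expR R k.
exists (C + D * `|c|) => [|x]; first by rewrite addr_ge0// mulr_ge0.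
rewrite hornerMXaddC.
have -> : x ^+ k * (p.[x] * x + c) = x ^+ k.+1 * p.[x] + x ^+ k * c.
  by rewrite exprS; ring.
rewrite (le_trans (ler_normD _ _))// mulrDl lerD//.
rewrite normrM normrX mulrAC.
by rewrite ler_wpM2r.
Qed.

Lemma continuous_horner_gauss (R : realType) (p : {poly R}) :
  continuous (fun x : R => p.[x] * gauss_fun x).
Proof.
by move=> x; apply: cvgM; [exact: continuous_horner|exact: continuous_gauss_fun].
Qed.

Lemma measurable_horner_gauss (R : realType) (p : {poly R}) (D : set R) :
  measurable_fun D (fun x : R => p.[x] * gauss_fun x).
Proof.
apply: measurable_funTS; apply: continuous_measurable_fun.
exact: continuous_horner_gauss.
Qed.

(** The dominating function is a multiple of the standard normal density; dividing by
    [normal_peak 1] removes its normalisation. *)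
Lemma integrable_horner_gauss (R : realType) (p : {poly R}) (D : set R) :
  measurable D ->
  lebesgue_measure.-integrable D (EFin \o (fun x : R => p.[x] * gauss_fun x)).
Proof.
move=> mD; apply: (@integrableS _ _ _ _ setT) => //.
have [C C0 hC] := horner_le_expR p.
have peak0 : 0 < normal_peak (1 : R) by rewrite normal_peak_gt0// oner_neq0.
have i1 := @integrableZl _ _ _ (@lebesgue_measure R) setT measurableT
  (C / normal_peak 1) _ (@integrable_normal_pdf R 0 1).
apply: le_integrable i1 => //.
  by apply/measurable_EFinP; exact: measurable_horner_gauss.
move=> x _ /=; rewrite lee_fin /normal_pdf oner_eq0 mulrA divfK ?gt_eqF//.
rewrite normrM (ger0_norm (gauss_fun_ge0 x)) normrM (ger0_norm C0).
rewrite /normal_fun (ger0_norm (expR_ge0 _)) /gauss_fun.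
have -> : - x ^+ 2 = - (x ^+ 2 / 2) + - (x - 0) ^+ 2 / (1 ^+ 2 *+ 2) by field.
rewrite expRD mulrA ler_wpM2r ?expR_ge0//.
by rewrite expRN ler_pdivrMr ?expR_gt0.
Qed.

Lemma cvg_horner_gauss (R : realType) (p : {poly R}) :
  (p.[n%:R] * gauss_fun n%:R : R) @[n --> \oo] --> (0 : R).
Proof.
have [C C0 hC] := horner_le_expR p.
apply: norm_cvg0.
apply: (@squeeze_cvgr _ _ _ _ (cst 0)
  (fun n : nat => C * expR 2^-1 * expR (- n%:R))).
- apply: nearW => n; rewrite normr_ge0/= normrM (ger0_norm (gauss_fun_ge0 _)).
  rewrite (le_trans (ler_wpM2r (gauss_fun_ge0 _) (hC _)))//.
  rewrite /gauss_fun -!mulrA -!expRD ler_wpM2l// ler_expR.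
  (* [(n - 1)^2 >= 0] says [n^2/2 - n^2 <= 1/2 - n], whence the constant [expR 2^-1]. *)
  have := sqr_ge0 (n%:R - 1 : R); lra.
- exact: cvg_cst.
- rewrite -[X in _ --> X](mulr0 (C * expR 2^-1)).
  by apply: cvgM; [exact: cvg_cst|exact: cvgn_expR].
Qed.

Lemma integral_deriv_horner_gauss (R : realType) (p : {poly R}) (a b : R) :
  a < b ->
  (\int[lebesgue_measure]_(x in `[a, b])
     ((p^`() - 2 *: ('X * p)).[x] * gauss_fun x)%:E =
   (p.[b] * gauss_fun b - p.[a] * gauss_fun a)%:E)%E.
Proof.
move=> ab; rewrite EFinB.
have dF (x : R) : is_derive x 1 (fun x => p.[x] * gauss_fun x)
    ((p^`() - 2 *: ('X * p)).[x] * gauss_fun x).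
  have dp : is_derive x 1 (horner p) p^`().[x].
    by rewrite derivE derive1E; apply/derivableP; exact: derivable_horner.
  have dg : is_derive x 1 gauss_fun (- (2 * x) * gauss_fun x).
    rewrite /gauss_fun; apply: is_derive_eq; rewrite /GRing.scale/=; ring.
  apply: is_derive_eq; rewrite !hornerE /GRing.scale/=; ring.
apply: (@continuous_FTC2 _ _ (fun x => p.[x] * gauss_fun x)) => //.
- by apply: continuous_subspaceT; exact: continuous_horner_gauss.
- split.
  + by move=> x _; apply: ex_derive.
  + by apply: cvg_at_right_filter; exact: continuous_horner_gauss.
  + by apply: cvg_at_left_filter; exact: continuous_horner_gauss.
- by move=> x _; rewrite derive1E derive_val.
Qed.

Lemma cvg_integral_truncation (R : realType) (D : set R) (f : R -> R) :
  measurable D -> lebesgue_measure.-integrable D (EFin \o f) ->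
  (\int[lebesgue_measure]_(x in D `&` `[(- n%:R)%R, n%:R%R]) (f x)%:E)%E
    @[n --> \oo] --> (\int[lebesgue_measure]_(x in D) (f x)%:E)%E.
Proof.
move=> mD intf.
under eq_cvg do rewrite integral_mkcondr.
apply: (@dominated_cvg _ _ _ (@lebesgue_measure R) _ mD
  (fun n => (EFin \o f) \_ `[- n%:R, n%:R]) (EFin \o f) (abse \o (EFin \o f))) => //.
- move=> n; apply/(measurable_restrict _ _ _) => //.
  apply: measurable_funS (measurable_int _ intf) => //.
- move=> x _; apply: cvg_near_cst.
  have [N xN] : exists N : nat, `|x| <= N%:R.
    by exists (Num.truncn `|x|).+1; rewrite ltW// truncnS_gt.
  exists N => // n /= Nn; rewrite patchT// inE/= in_itv/= -ler_norml.
  by rewrite (le_trans xN)// ler_nat.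
- exact: integrable_abse.
- move=> n x _; rewrite patchE; case: ifP => // _.
  by rewrite abse0 abse_ge0.
Qed.

Definition gauss_int (R : realType) (D : set R) (p : {poly R}) : R :=
  Rintegral lebesgue_measure D (fun x => p.[x] * gauss_fun x).

Lemma gauss_intD (R : realType) (D : set R) (p q : {poly R}) : measurable D ->
  gauss_int D (p + q) = gauss_int D p + gauss_int D q.
Proof.
move=> mD; rewrite /gauss_int -RintegralD//; try exact: integrable_horner_gauss.
by apply: eq_Rintegral => x _; rewrite hornerD mulrDl.
Qed.

Lemma gauss_intZ (R : realType) (D : set R) (c : R) (p : {poly R}) :
  measurable D -> gauss_int D (c *: p) = c * gauss_int D p.
Proof.
move=> mD; rewrite /gauss_int -RintegralZl//; last exact: integrable_horner_gauss.
by apply: eq_Rintegral => x _; rewrite hornerZ mulrA.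
Qed.

Lemma gauss_int0 (R : realType) (D : set R) : measurable D -> gauss_int D 0 = 0.
Proof.
move=> mD; rewrite -[X in gauss_int _ X](scale0r (0 : {poly R})) gauss_intZ//.
by rewrite mul0r.
Qed.

(** Dominated convergence reduces an improper integral to its truncations. Cutting at [n.+1] keeps
    each interval nondegenerate, as the fundamental theorem of calculus requires. *)
Lemma gauss_int_lim (R : realType) (D : set R) (p : {poly R}) (u : nat -> R)
    (l : R) : measurable D ->
  (forall n, (\int[lebesgue_measure]_(x in D `&` `[(- n.+1%:R)%R, n.+1%:R%R])
     (p.[x] * gauss_fun x)%:E = (u n)%:E)%E) ->
  u n @[n --> \oo] --> l -> gauss_int D p = l.
Proof.
move=> mD hu ul; rewrite /gauss_int /Rintegral.
have := cvg_integral_truncation mD (integrable_horner_gauss p mD).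
rewrite -cvg_shiftS/= => /cvg_lim <- //.
have -> : l = fine l%:E by [].
congr fine; apply/cvg_lim => //.
under eq_cvg do rewrite hu.
by apply: cvg_EFin; [exact: nearW|].
Qed.

Lemma gauss_intT_deriv (R : realType) (p : {poly R}) :
  gauss_int setT p^`() = 2 * gauss_int setT ('X * p).
Proof.
apply/eqP; rewrite -subr_eq0 -mulNr -gauss_intZ// -gauss_intD// scaleNr.
apply/eqP; apply: (@gauss_int_lim _ _ _ (fun n : nat =>
  p.[n.+1%:R] * gauss_fun n.+1%:R - p.[- n.+1%:R] * gauss_fun (- n.+1%:R))) => //.
  move=> n; rewrite setTI integral_deriv_horner_gauss//.
  by rewrite (@lt_trans _ _ 0)// ?oppr_lt0 ltr0n.
rewrite -[X in _ --> X](subr0 0).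
apply: (@cvgB _ R^o).
  have := @cvg_horner_gauss R p.
  by rewrite -cvg_shiftS/=.
(* The boundary term at [- n.+1] is the one of [p(-x)] at [n.+1]. *)
have := @cvg_horner_gauss R (p \Po - 'X).
rewrite -cvg_shiftS/=; apply: cvg_trans; apply: near_eq_cvg.
by apply: nearW => n; rewrite horner_comp !hornerE /gauss_fun sqrrN.
Qed.

Lemma gauss_int0y_deriv (R : realType) (p : {poly R}) :
  gauss_int `[0, +oo[ p^`() = 2 * gauss_int `[0, +oo[ ('X * p) - p.[0].
Proof.
apply/eqP; rewrite addrC -subr_eq -mulNr -gauss_intZ// -gauss_intD// scaleNr.
apply/eqP; apply: (@gauss_int_lim _ _ _ (fun n : nat =>
  p.[n.+1%:R] * gauss_fun n.+1%:R - p.[0] * gauss_fun 0)) => //.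
  move=> n; rewrite -integral_deriv_horner_gauss//.
  congr (integral _ _ _); apply/seteqP; split => x /=; rewrite !in_itv/= ?andbT.
    by move=> [-> /andP[]].
  by move=> /andP[x0 ->]; rewrite x0 (le_trans _ x0)// oppr_le0.
rewrite -[X in _ --> X]sub0r.
apply: (@cvgB _ R^o).
  have := @cvg_horner_gauss R p.
  by rewrite -cvg_shiftS/=.
rewrite /gauss_fun expr0n oppr0 expR0 mulr1; exact: cvg_cst.
Qed.

Lemma gauss_intT1 (R : realType) : gauss_int setT 1 = Num.sqrt pi :> R.
Proof.
rewrite /gauss_int /Rintegral -[RHS]/(fine (Num.sqrt pi)%:E) -integralT_gauss.
by congr fine; apply: eq_integral => x _; rewrite hornerC mul1r.
Qed.

Lemma gauss_int0y1 (R : realType) :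
  gauss_int `[0, +oo[ 1 = Num.sqrt pi / 2 :> R.
Proof.
rewrite /gauss_int /Rintegral -[RHS]/(fine (Num.sqrt pi / 2)%:E).
rewrite -integral0y_gauss.
by congr fine; apply: eq_integral => x _; rewrite hornerC mul1r.
Qed.

(** * The Gamma function at integers and half-integers *)

(** With [t = x^2], [t^(k/2) e^(-t) dt] becomes [2 x^(k+1) e^(-x^2) dx]. Gamma values thus become
    Gaussian moments on the half-line, where integration by parts is available. *)
Lemma Gamma_half (R : realType) (k : nat) :
  Gamma (k%:R / 2 + 1) = 2 * gauss_int `[0, +oo[ 'X^(k.+1) :> R.
Proof.
pose g (t : R) := Num.sqrt t ^+ k * expR (- t).
have cg : continuous g.
  move=> x; apply: cvgM.
    apply: (cvg_comp (fun z => Num.sqrt z) (fun z => z ^+ k)).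
      exact: sqrt_continuous.
    exact: exprn_continuous.
  apply: (@continuous_comp _ _ _ (fun x : R => - x) expR).
    exact: opp_continuous.
  exact: continuous_expR.
have g0 x : 0 <= g x by rewrite mulr_ge0// ?exprn_ge0// ?sqrtr_ge0// expR_ge0.
have mg : measurable_fun setT g by exact: continuous_measurable_fun.
rewrite -gauss_intZ// /gauss_int /Gamma.
transitivity (\int[lebesgue_measure]_(t in `[0, +oo[) g t).
  apply: eq_Rintegral => t; rewrite inE/= in_itv/= andbT => t0.
  by rewrite addrK (mulrC k%:R) powRrM powR12_sqrt// powR_mulrn// ?sqrtr_ge0.
congr fine.
have Dsqr (x : R) : (fun x : R => x ^+ 2)^`()%classic x = 2 * x.
  by rewrite derive1E derive_val /GRing.scale/=; ring.
(* Substitution t = x^2 on a bounded interval: the library's version on a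
   half-line requires the derivative 2x to converge at infinity. *)
have sub (b : R) : 0 < b ->
    (\int[lebesgue_measure]_(x in `[0%R, (b ^+ 2)%R]) (g x)%:E =
     \int[lebesgue_measure]_(x in `[0%R, b])
       ((2 *: 'X^(k.+1)).[x] * gauss_fun x)%:E)%E.
  move=> b0; have -> : `[0, b ^+ 2] = `[0 ^+ 2, b ^+ 2] :> interval R.
    by rewrite expr0n.
  rewrite (@integration_by_substitution_increasing _ (fun x : R => x ^+ 2))//.
  - apply: eq_integral => x; rewrite inE/= in_itv/= => /andP[x0 _].
    rewrite fctE /= Dsqr /g sqrtr_sqr ger0_norm// hornerZ hornerXn (exprS _ k).
    by congr EFin; rewrite /gauss_fun; ring.
  - exact: ltW.
  - move=> x y; rewrite !in_itv/= => /andP[x0 _] /andP[y0 _] xy.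
    by rewrite ltr_pXn2r.
  - by rewrite (funext Dsqr) => x _; apply: cvgM; [exact: cvg_cst|exact: cvg_id].
  - rewrite (funext Dsqr); apply/cvg_ex; exists (2 * 0).
    by apply: cvg_at_right_filter; apply: cvgM; [exact: cvg_cst|exact: cvg_id].
  - rewrite (funext Dsqr); apply/cvg_ex; exists (2 * b).
    by apply: cvg_at_left_filter; apply: cvgM; [exact: cvg_cst|exact: cvg_id].
  - split.
    + by move=> x _; exact: exprn_derivable.
    + by apply: cvg_at_right_filter; exact: exprn_continuous.
    + by apply: cvg_at_left_filter; exact: exprn_continuous.
  - exact: continuous_subspaceT.
(* Truncating [t] along the squares [(n+1)^2] matches truncating [x] at [n+1]. *)
have := @ge0_cvgn_integral R lebesgue_measure g g0 mg.
move=> /(cvg_comp (fun n : nat => (n.+1 ^ 2)%N) _ _) => /(_ \oo) H.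
have /H {H} : (n.+1 ^ 2)%N @[n --> \oo] --> \oo.
  apply/cvgnyPge => N; exists N => // n /= Nn.
  by rewrite (leq_trans Nn)// (leq_trans (leqnSn n))// leq_pmull.
move=> /cvg_lim <- //; apply/cvg_lim => //.
have := cvg_integral_truncation _
  (integrable_horner_gauss (2 *: 'X^(k.+1)) (measurable_itv `[(0 : R), +oo[)).
move=> /(_ (measurable_itv _)); rewrite -cvg_shiftS/=.
apply: cvg_trans; apply: near_eq_cvg; apply: nearW => n /=.
rewrite natrX sub//; congr (integral _ _ _).
apply/seteqP; split => x /=; rewrite !in_itv/= ?andbT.
  by move=> [-> /andP[]].
by move=> /andP[x0 ->]; rewrite x0 (le_trans _ x0)// oppr_le0.
Qed.

Lemma Gamma_nat (R : realType) (m : nat) :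
  Gamma (m.+1%:R : R) = 2 * gauss_int `[0, +oo[ 'X^(m.*2.+1).
Proof. by rewrite -Gamma_half -muln2 natrM mulfK// natr1. Qed.

Lemma Gamma_nat_half (R : realType) (m : nat) :
  Gamma (m%:R + 3 / 2 : R) = 2 * gauss_int `[0, +oo[ 'X^(m.*2.+2).
Proof.
rewrite -Gamma_half; congr Gamma.
by rewrite -(natr1 m.*2) -muln2 natrM; by field.
Qed.

Lemma gauss_int0y_XnSS (R : realType) (k : nat) :
  gauss_int `[0, +oo[ 'X^(k.+2) = k.+1%:R / 2 * gauss_int `[0, +oo[ 'X^k :> R.
Proof.
have := @gauss_int0y_deriv R 'X^(k.+1).
rewrite derivXn -scaler_nat gauss_intZ// -exprS hornerXn expr0n subr0/=.
by move=> h; rewrite mulrAC h; field.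
Qed.

Lemma Gamma_natS (R : realType) (m : nat) :
  Gamma (m.+2%:R : R) = m.+1%:R * Gamma m.+1%:R.
Proof.
rewrite !Gamma_nat doubleS gauss_int0y_XnSS.
rewrite -[m.*2.+2]/(m.+1.*2) -muln2 natrM; by field.
Qed.

Lemma Gamma_nat_halfS (R : realType) (m : nat) :
  Gamma (m.+1%:R + 3 / 2 : R) = (m%:R + 3 / 2) * Gamma (m%:R + 3 / 2).
Proof.
rewrite !Gamma_nat_half doubleS gauss_int0y_XnSS.
rewrite -(natr1 m.*2.+2) -[m.*2.+2]/(m.+1.*2) -muln2 natrM -natr1; by field.
Qed.

Lemma Gamma1 (R : realType) : Gamma 1 = 1 :> R.
Proof.
rewrite -[1 in LHS]/(1%:R) Gamma_nat.
have := @gauss_int0y_deriv R 1%:P.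
rewrite derivC gauss_int0// hornerC mulr1 => /eqP.
by rewrite eq_sym subr_eq add0r => /eqP.
Qed.

Lemma Gamma3half (R : realType) : Gamma (3 / 2) = Num.sqrt pi / 2 :> R.
Proof.
rewrite -[3 / 2]add0r -[0]/(0%:R) Gamma_nat_half double0 gauss_int0y_XnSS gauss_int0y1.
by field.
Qed.

(** * Hermite polynomials and the bilinear form *)

(** Identifies the quotient by [x^2] inside [form2] as a polynomial, so that its integrand becomes a
    polynomial times the Gaussian. *)
Lemma horner_drop2 (R : comNzRingType) (p : {poly R}) (x : R) :
  p.[x] = p.[0] + p^`().[0] * x + (drop_poly 2 p).[x] * x ^+ 2.
Proof.
rewrite -[in LHS](poly_take_drop 2 p) hornerD hornerM hornerXn; congr (_ + _).
rewrite /take_poly horner_poly !big_ord_recl big_ord0 addr0/= expr0 expr1 mulr1.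
by rewrite !horner_coef0 coef_deriv mulr1n.
Qed.

Lemma form2E (R : realType) (A : R) (p q : {poly R}) :
  form2 A p q = gauss_int setT (drop_poly 2 (p * q))
    - 2 * Num.sqrt pi * (p.[0] * q.[0]) + A * (p^`().[0] * q^`().[0]).
Proof.
rewrite /form2; congr (_ - _ + _).
set r := drop_poly 2 (p * q).
(* At 0 the integrand of [form2] takes the default value of a division by zero, so this null point
   is removed from both integrals. *)
have e : {in [set: R] `\ 0, (fun x => r.[x] * gauss_fun x) =1 (fun x =>
    (p.[x] * q.[x] - (p * q).[0] - ((p * q)^`()).[0] * x) / x ^+ 2
      * expR (- x ^+ 2))}.
  move=> x; rewrite inE => -[_ /eqP x0]; rewrite /gauss_fun; congr (_ * _).
  rewrite -hornerM (horner_drop2 (p * q) x) -/r.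
  by field.
have m0 : measurable ([set: R] `\ 0) by exact: measurableD.
have mr : measurable_fun ([set: R] `\ 0) (fun x => r.[x] * gauss_fun x).
  exact: measurable_horner_gauss.
rewrite /gauss_int /Rintegral; congr fine.
rewrite -[LHS](@integral_setD1 _ _ 0)//; last first.
  by apply/measurable_EFinP; exact: eq_measurable_fun mr.
rewrite -[RHS](@integral_setD1 _ _ 0)//; last by apply/measurable_EFinP.
by apply: eq_integral => x x0; rewrite -e.
Qed.

Lemma gauss_intTX (R : realType) : gauss_int setT 'X = 0 :> R.
Proof.
have := @gauss_intT_deriv R 1; rewrite -{1}[1]/(1%:P) derivC gauss_int0// mulr1.
by lra.
Qed.

Lemma gauss_intTXX (R : realType) : gauss_int setT ('X * 'X) = Num.sqrt pi / 2 :> R.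
Proof.
by have := @gauss_intT_deriv R 'X; rewrite derivX gauss_intT1 => ->; field.
Qed.

Lemma hermite_deriv (R : realType) (n : nat) :
  (hermite R n.+1)^`() = n.+1%:R *: hermite R n.
Proof.
elim/ltn_ind: n => -[|[|n]] IH.
- by rewrite /= derivX scale1r.
- rewrite /= derivB derivM derivZ derivX derivC scaler0 subr0.
  by rewrite mul1r mulr1 scaler_nat.
have H2 k : hermite R k.+2 = 'X * hermite R k.+1 - (k.+1%:R / 2) *: hermite R k.
  by [].
rewrite [in LHS]H2 derivB derivM derivX derivZ mul1r !IH//.
rewrite -scalerAr (H2 n); apply/polyP => i; rewrite !coefE.
by rewrite -(natr1 n.+2) -(natr1 n.+1); field.
Qed.

(** The raising operator: under the Gaussian integral its adjoint is [q |-> q'/2], which lowers the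
    degree and drives the induction for orthogonality. *)
Lemma hermiteS (R : realType) (n : nat) :
  hermite R n.+1 = 'X * hermite R n - 2^-1 *: (hermite R n)^`().
Proof.
case: n => [|n]; first by rewrite /= derivC scaler0 subr0 mulr1.
by rewrite hermite_deriv scalerA (mulrC 2^-1).
Qed.

Lemma hermite_orthogonal (R : realType) (n : nat) (q : {poly R}) :
  (size q <= n)%N -> gauss_int setT (hermite R n * q) = 0.
Proof.
elim: n q => [|n IH] q sq.
  by move: sq; rewrite leqn0 size_poly_eq0 => /eqP ->; rewrite mulr0 gauss_int0.
(* H_(n+1) q = x (H_n q) - ((H_n q)' - H_n q') / 2, and integration by parts
   cancels the first two terms. *)
have e : hermite R n.+1 * q = 'X * (hermite R n * q) +
    (- 2^-1) *: ((hermite R n * q)^`() + (-1) *: (hermite R n * q^`())).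
  by rewrite hermiteS derivM scaleN1r addrK scaleNr mulrBl mulrA scalerAl.
rewrite e gauss_intD// gauss_intZ// gauss_intD// gauss_intZ// gauss_intT_deriv.
rewrite IH; last by rewrite (leq_trans (size_poly _ _))//; case: (size q) sq.
by field.
Qed.

Lemma mulX_hermite (R : realType) (n : nat) :
  'X * hermite R n = hermite R n.+1 + (n%:R / 2) *: hermite R n.-1.
Proof.
case: n => [|n]; first by rewrite mul0r scale0r addr0 mulr1.
by rewrite /= subrK.
Qed.

(** For [n = 0, 1] the truncated index [n - 2] is 0, but its coefficient [n (n - 1) / 4]
    vanishes. *)
Lemma mulX2_hermite (R : realType) (n : nat) :
  'X^2 * hermite R n = hermite R n.+2 + (n%:R + 2^-1) *: hermite R n
    + (n%:R * (n%:R - 1) / 4) *: hermite R (n - 2).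
Proof.
rewrite expr2 -mulrA mulX_hermite mulrDr -scalerAr !mulX_hermite.
case: n => [|n] /=.
  by apply/polyP => i; rewrite !coefE; field.
by rewrite subSS subn1; apply/polyP => i; rewrite !coefE -(natr1 n); field.
Qed.

Lemma hermite_monic (R : realType) (n : nat) :
  size (hermite R n) = n.+1 /\ hermite R n \is monic.
Proof.
elim/ltn_ind: n => -[|[|n]] IH.
- by rewrite size_poly1 monic1.
- by rewrite size_polyX monicX.
have [s1 m1] := IH n.+1 (ltnSn _); have [s0 _] := IH n (leqnSn _).
have sX : size ('X * hermite R n.+1) = n.+3.
  by rewrite mulrC size_mulX ?s1// monic_neq0.
have lt : (size (- ((n.+1%:R / 2) *: hermite R n))%R < size ('X * hermite R n.+1)%R)%N.
  by rewrite size_polyN sX ltnS (leq_trans (size_scale_leq _ _))// s0.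
have -> : hermite R n.+2 = 'X * hermite R n.+1 - (n.+1%:R / 2) *: hermite R n by [].
split; first by rewrite size_polyDl.
by rewrite monicE lead_coefDl// -monicE monicMr// monicX.
Qed.

Lemma form2C (R : realType) (A : R) (p q : {poly R}) :
  form2 A p q = form2 A q p.
Proof. by rewrite !form2E (mulrC p q) (mulrC p.[0]) (mulrC p^`().[0]). Qed.

Lemma form2_linear (R : realType) (A c : R) (p r q : {poly R}) :
  form2 A (c *: p + r) q = c * form2 A p q + form2 A r q.
Proof.
rewrite !form2E mulrDl -scalerAl drop_polyD drop_polyZ gauss_intD// gauss_intZ//.
rewrite derivD derivZ !hornerD !hornerZ; ring.
Qed.

Lemma form2_0l (R : realType) (A : R) (q : {poly R}) : form2 A 0 q = 0.
Proof. by have := form2_linear A 1 0 0 q; rewrite scale1r addr0; lra. Qed.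

(** The factor [x^2] cancels the denominator and has a double zero at 0, which kills both point
    terms. *)
Lemma form2_X2 (R : realType) (A : R) (p q : {poly R}) :
  form2 A ('X^2 * p) q = gauss_int setT (p * q).
Proof.
rewrite form2E -mulrA (mulrC 'X^2) drop_polyMXn_id derivM derivXn !hornerE /=.
ring.
Qed.

Lemma form2_11 (R : realType) (A : R) : form2 A 1 1 = - (2 * Num.sqrt pi).
Proof.
rewrite form2E mulr1 drop_poly_eq0 ?size_poly1// gauss_int0//.
by rewrite -(polyC1 R) derivC !hornerE /=; ring.
Qed.

Lemma form2_1X (R : realType) (A : R) : form2 A 1 'X = 0.
Proof.
rewrite form2E mul1r drop_poly_eq0 ?size_polyX// gauss_int0//.
by rewrite -(polyC1 R) derivC !hornerE /=; ring.
Qed.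

Lemma form2_XX (R : realType) (A : R) : form2 A 'X 'X = Num.sqrt pi + A.
Proof.
rewrite form2E -expr2 -[X in drop_poly _ X]mul1r drop_polyMXn_id gauss_intT1.
by rewrite derivX !hornerE /=; ring.
Qed.

(** Split [q] as [q_0 + q_1 x + x^2 r] with [size r <= k]; on the last summand the form is a
    Gaussian integral. *)
Lemma form2_orthogonal (R : realType) (A : R) (p q : {poly R}) (k : nat) :
  form2 A p 1 = 0 -> form2 A p 'X = 0 ->
  (forall r : {poly R}, (size r <= k)%N -> gauss_int setT (p * r) = 0) ->
  (size q <= k.+2)%N -> form2 A p q = 0.
Proof.
move=> p1 pX pr sq.
have -> : q = q`_1 *: 'X + (q`_0 *: 1 + 'X^2 * drop_poly 2 q).
  rewrite -[LHS](poly_take_drop 2 q) addrA (mulrC 'X^2); congr (_ + _).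
  rewrite /take_poly poly_def !big_ord_recl big_ord0 addr0/= addrC.
  by rewrite expr0 expr1.
rewrite form2C !form2_linear form2_X2 !(form2C _ _ p) p1 pX (mulrC _ p) pr ?mulr0 ?addr0//.
by rewrite size_drop_poly leq_subLR.
Qed.

(** This is [mulX2_hermite] solved for its leading term; the Gaussian integral disappears once
    [size q <= n]. *)
Lemma form2_hermiteSS (R : realType) (A : R) (n : nat) (q : {poly R}) :
  form2 A (hermite R n.+2) q = gauss_int setT (hermite R n * q)
    - (n%:R + 2^-1) * form2 A (hermite R n) q
    - n%:R * (n%:R - 1) / 4 * form2 A (hermite R (n - 2)) q.
Proof.
have e : hermite R n.+2 = (- (n%:R + 2^-1)) *: hermite R n +
    ((- (n%:R * (n%:R - 1) / 4)) *: hermite R (n - 2) + 'X^2 * hermite R n).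
  rewrite mulX2_hermite; apply/polyP => i; rewrite !coefE; ring.
by rewrite e !form2_linear form2_X2; ring.
Qed.

Lemma form2_hermite_parity (R : realType) (A : R) (m : nat) :
  form2 A (hermite R m.*2) 'X = 0 /\ form2 A (hermite R m.*2.+1) 1 = 0.
Proof.
elim/ltn_ind: m => -[|m] IH; first by rewrite form2_1X form2C form2_1X.
have [e o] := IH m (ltnSn m).
(* For [m = 0] the truncated index [m.*2.+1 - 2] is 0 and [[1, 1]] is not zero; there the
   coefficient [n (n - 1)] at [n = 1] vanishes instead. *)
have [e' o'] : form2 A (hermite R (m.*2 - 2)) 'X = 0 /\
    (m == 0%N \/ form2 A (hermite R (m.*2.+1 - 2)) 1 = 0).
  case: m IH {e o} => [|m] IH; first by rewrite form2_1X; split => //; left.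
  have [e o] := IH m (leqnSn _).
  by rewrite doubleS !subSS !subn0; split => //; right.
rewrite doubleS !form2_hermiteSS e e' o !mulr0 !subr0; split.
  case: m {IH e o e' o'} => [|m]; first by rewrite mul1r gauss_intTX.
  by rewrite hermite_orthogonal// size_polyX.
rewrite hermite_orthogonal ?size_poly1//.
by case: o' => [/eqP ->|->]; rewrite /= ?subrr; ring.
Qed.

(* Up to sign and a factor 2 sqrt pi, the value [gamma_comb (4 * A) m] is
   [H_(2m+1), x]; lambda_(2m+3) is a ratio of two consecutive such values. *)
Definition gamma_comb (R : realType) (B : R) (m : nat) : R :=
  2 * pi * Gamma m.+1%:R + Gamma (m%:R + 3 / 2) * B.

Lemma gamma_comb0 (R : realType) (B : R) :
  gamma_comb B 0 = 2 * pi + Num.sqrt pi / 2 * B.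
Proof. by rewrite /gamma_comb Gamma1 add0r Gamma3half mulr1. Qed.

Lemma gamma_comb1 (R : realType) (B : R) :
  gamma_comb B 1 = 2 * pi + 3 / 4 * Num.sqrt pi * B.
Proof.
by rewrite /gamma_comb Gamma_natS Gamma_nat_halfS Gamma1 add0r Gamma3half; field.
Qed.

(** [Gamma (m + 1)] and [Gamma (m + 3/2)] solve this same recurrence, hence so does any combination.
    Up to signs it is the recurrence of [[H_(2m+1), x]]. *)
Lemma gamma_combSS (R : realType) (B : R) (m : nat) :
  gamma_comb B m.+2 = (2 * m%:R + 7 / 2) * gamma_comb B m.+1
    - (m%:R + 1) * (m%:R + 3 / 2) * gamma_comb B m.
Proof.
rewrite /gamma_comb !Gamma_natS !Gamma_nat_halfS.
by rewrite -(natr1 m.+1) -(natr1 m); field.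
Qed.

Lemma lambda_even (R : realType) (B : R) (m : nat) : lambda B m.*2 = m%:R.
Proof. by rewrite /lambda odd_double doubleK. Qed.


Lemma lambda_odd (R : realType) (B : R) (m : nat) :
  lambda B m.*2.+3 = gamma_comb B m.+1 / gamma_comb B m.
Proof.
rewrite /lambda -[m.*2.+3]/(true + m.+1.*2)%N half_bit_double oddD odd_double/=.
have -> : m.+1%:R + 1 / 2 = m%:R + 3 / 2 :> R by rewrite -(natr1 m); field.
by rewrite natr1.
Qed.

Lemma lambda_neq0 (R : realType) (B : R) (n : nat) :
  (forall m, gamma_comb B m != 0) -> lambda B n.+2 != 0.
Proof.
move=> D0; rewrite -(odd_double_half n.+2) /= negbK.
case: (odd n); first by rewrite add1n doubleS lambda_odd mulf_neq0 ?invr_neq0.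
by rewrite add0n lambda_even pnatr_eq0.
Qed.

(** At odd indices this is [gamma_combSS] divided by its middle term; at even indices it is an
    identity between rational functions of [m]. *)
Lemma lambda_rec (R : realType) (B : R) (n : nat) :
  (forall m, gamma_comb B m != 0) ->
  lambda B n.+4 = n%:R + 5 / 2 - (n%:R + 2) * (n%:R + 1) / (4 * lambda B n.+2).
Proof.
move=> D0; rewrite -(odd_double_half n); set m := n./2; case: (odd n).
  rewrite add1n -doubleS !lambda_odd gamma_combSS -(natr1 m.*2) -muln2 natrM.
  move: (D0 m) (D0 m.+1).
  move: (gamma_comb B m) (gamma_comb B m.+1) => x y x0 y0.
  by field; rewrite x0 y0.
rewrite add0n -!doubleS !lambda_even -muln2 natrM.
rewrite -(natr1 m.+1) -(natr1 m).
by field; rewrite natr1 pnatr_eq0.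
Qed.

(** * Identification of the orthogonal polynomials *)

(** Both sides obey the same second-order recurrence. The mass [4 * A] is dictated by [m = 0], where
    [sqrt pi + A = (2 pi + (sqrt pi / 2) (4 A)) / (2 sqrt pi)]. *)
Lemma form2_hermite_odd_X (R : realType) (A : R) (m : nat) :
  form2 A (hermite R m.*2.+1) 'X =
  (-1) ^+ m * gamma_comb (4 * A) m / (2 * Num.sqrt pi).
Proof.
have s0 : Num.sqrt pi != 0 :> R by rewrite gt_eqF// sqrtr_gt0 pi_gt0.
have pis : pi = Num.sqrt pi ^+ 2 :> R by rewrite sqr_sqrtr// pi_ge0.
elim/ltn_ind: m => -[|[|m]] IH.
- rewrite gamma_comb0 form2_XX [X in 2 * X]pis; by field.
- rewrite form2_hermiteSS form2_XX gauss_intTXX gamma_comb1 [X in 2 * X]pis.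
  by rewrite subrr; field.
rewrite doubleS form2_hermiteSS doubleS hermite_orthogonal ?size_polyX//.
rewrite -[(m.*2.+3 - 2)%N]/(m.*2.+1) -[m.*2.+3]/(m.+1.*2.+1) !IH//.
rewrite gamma_combSS !exprS -(natr1 m.+1.*2) -muln2 natrM -(natr1 m).
by field.
Qed.

Lemma monic_basis (R : fieldType) (S : nat -> {poly R}) (n : nat) (q : {poly R}) :
  (forall k, S k \is monic /\ size (S k) = k.+1) -> (size q <= n)%N ->
  exists c : nat -> R, q = \sum_(k < n) c k *: S k.
Proof.
move=> hS; elim: n q => [|n IH] q sq.
  exists (fun=> 0); rewrite big_ord0; apply/eqP.
  by rewrite -size_poly_eq0 -leqn0.
have [|c hc] := IH (q - q`_n *: S n).
  apply/leq_sizeP => j; rewrite leq_eqVlt => /predU1P[<-|nj].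
    have [/monicP] := hS n; rewrite lead_coefE => + sn; rewrite sn/= => mn.
    by rewrite !coefE mn mulr1 subrr.
  have [_ sn] := hS n.
  rewrite !coefE [(S n)`_j]nth_default ?sn// nth_default; last exact: leq_trans sq nj.
  by rewrite mulr0 subr0.
exists (fun k => if k == n then q`_n else c k).
rewrite big_ord_recr/= eqxx -[LHS](subrK (q`_n *: S n)) [X in X + _]hc.
by congr (_ + _); apply: eq_bigr => i _; rewrite ltn_eqF.
Qed.

Lemma form2_sum (R : realType) (A : R) (n : nat) (c : nat -> R)
    (S : nat -> {poly R}) (q : {poly R}) :
  form2 A (\sum_(k < n) c k *: S k) q = \sum_(k < n) c k * form2 A (S k) q.
Proof.
elim: n => [|n IH]; first by rewrite !big_ord0 form2_0l.
by rewrite !big_ord_recr/= addrC form2_linear IH addrC.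
Qed.

Lemma orthogonal_lower (R : realType) (A : R) (S : nat -> {poly R}) (n : nat)
    (q : {poly R}) : monic_orthogonal (form2 A) S ->
  (size q <= n)%N -> form2 A (S n) q = 0.
Proof.
move=> [hS [K [_ hK]]] /(monic_basis hS)[c ->].
rewrite form2C form2_sum big1// => i _.
by rewrite hK ltn_eqF// !mulr0.
Qed.

(** Pairing [p] with [S i] isolates its [i]-th coordinate times the nonzero [K i]. *)
Lemma form2_nondegenerate (R : realType) (A : R) (S : nat -> {poly R}) (n : nat)
    (p : {poly R}) : monic_orthogonal (form2 A) S -> (size p <= n)%N ->
  (forall q : {poly R}, (size q <= n)%N -> form2 A p q = 0) -> p = 0.
Proof.
move=> [hS [K [K0 hK]]] sp hp; have [c hc] := monic_basis hS sp.
rewrite hc big1// => i _; suff -> : c i = 0 by rewrite scale0r.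
have : form2 A p (S i) = 0 by apply: hp; have [_ ->] := hS i.
rewrite hc form2_sum (bigD1 i)//= hK eqxx mulr1 big1 ?addr0.
  by move=> /eqP; rewrite mulf_eq0 (negPf (K0 _)) orbF => /eqP.
by move=> j ji; rewrite hK (negPf (_ : j != i :> nat)) ?mulr0//.
Qed.

Lemma gamma_comb_neq0 (R : realType) (A : R) (S : nat -> {poly R}) (m : nat) :
  monic_orthogonal (form2 A) S -> gamma_comb (4 * A) m != 0.
Proof.
move=> hS; apply/eqP => g0.
have [sH mH] := hermite_monic R m.*2.+1.
have /eqP : hermite R m.*2.+1 = 0.
  apply: (form2_nondegenerate hS) (leqnn _) _ => q; rewrite sH => sq.
  apply: (@form2_orthogonal _ _ _ _ m.*2.+1) (leqW sq).
  - by have [] := form2_hermite_parity A m.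
  - by rewrite form2_hermite_odd_X g0 mulr0 mul0r.
  - exact: hermite_orthogonal.
by rewrite (negPf (monic_neq0 mH)).
Qed.

Lemma form2_hermite_lambda (R : realType) (A : R) (n : nat) (q : {poly R}) :
  (forall m, gamma_comb (4 * A) m != 0) -> (q == 1) || (q == 'X) ->
  form2 A (hermite R n.+2) q
    + lambda (4 * A) n.+2 * form2 A (hermite R n) q = 0.
Proof.
move=> D0 hq.
have sq : (size q <= 2)%N.
  by case/orP: hq => /eqP ->; rewrite ?size_poly1 ?size_polyX.
elim/ltn_ind: n => -[|[|n]] IH.
- rewrite -[2%N]/(1.*2) lambda_even form2_hermiteSS mul0r mul0r mul0r.
  case/orP: hq => /eqP ->; rewrite mul1r ?form2_11 ?gauss_intT1; first by field.
  by rewrite form2_1X gauss_intTX; ring.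
- case/orP: hq => /eqP ->.
    have [_ ->] := form2_hermite_parity A 1; have [_ ->] := form2_hermite_parity A 0.
    by rewrite mulr0 addr0.
  rewrite -[3%N]/(0.*2.+3) lambda_odd (form2_hermite_odd_X A 1).
  rewrite (form2_hermite_odd_X A 0) expr1 expr0.
  have s0 : Num.sqrt pi != 0 :> R by rewrite gt_eqF// sqrtr_gt0 pi_gt0.
  by field; rewrite s0 D0.
have /(canRL (addrK _)) := IH n (leqnSn _); rewrite sub0r => h.
have l0 := lambda_neq0 n D0.
rewrite lambda_rec// form2_hermiteSS hermite_orthogonal ?(leq_trans sq)//.
rewrite !subSS subn0.
(* Eliminating [[H_n, q]] divides by [lambda_(n+2)], which produces the quotient in [lambda_rec]. *)
have -> : form2 A (hermite R n) q =
    - (form2 A (hermite R n.+2) q / lambda (4 * A) n.+2).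
  by rewrite h; field.
rewrite -(natr1 n.+1) -(natr1 n); field.
by rewrite l0.
Qed.

Lemma hermite_connection_lambda (R : realType) (A : R) (S : nat -> {poly R}) :
  monic_orthogonal (form2 A) S -> hermite_connection S (lambda (4 * A)).
Proof.
move=> hS [|[|n]]// _; rewrite !subSS subn0.
have D0 m := gamma_comb_neq0 m hS.
have [sS mS] : size (S n.+2) = n.+3 /\ S n.+2 \is monic by case: hS => /(_ n.+2)[].
have [sH mH] := hermite_monic R n.+2; have [sH0 _] := hermite_monic R n.
set T := _ + _; have e : forall q : {poly R}, form2 A T q =
    form2 A (hermite R n.+2) q + lambda (4 * A) n.+2 * form2 A (hermite R n) q.
  by move=> q; rewrite /T addrC form2_linear addrC.
apply/eqP; rewrite -subr_eq0; apply/eqP.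
(* Both polynomials are monic of degree [n + 2], so the difference has lower degree, and it remains
   to test it against lower degrees. *)
apply: (@form2_nondegenerate _ A S n.+2) => //.
  apply/leq_sizeP => j; rewrite leq_eqVlt => /predU1P[<-|nj].
    have cS : (S n.+2)`_n.+2 = 1 by move: mS; rewrite monicE lead_coefE sS => /eqP.
    have cH : (hermite R n.+2)`_n.+2 = 1.
      by move: mH; rewrite monicE lead_coefE sH => /eqP.
    by rewrite coefB coefD coefZ cS cH [_`_n.+2]nth_default ?sH0// mulr0 addr0 subrr.
  have nj' : (n < j)%N by rewrite (leq_trans _ nj)// leqW.
  by rewrite coefB coefD coefZ !nth_default ?sS ?sH ?sH0// mulr0 addr0 subrr.
move=> q sq; rewrite addrC -scaleN1r form2_linear (orthogonal_lower hS)// addr0.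
rewrite (@form2_orthogonal _ _ _ _ n) ?mulr0//.
- by rewrite e form2_hermite_lambda// eqxx.
- by rewrite e form2_hermite_lambda// eqxx orbT.
move=> r sr; rewrite mulrDl -scalerAl gauss_intD// gauss_intZ//.
by rewrite !hermite_orthogonal ?mulr0 ?addr0// !leqW.
Qed.

(** * The five-term recurrence *)

Lemma orthogonal_S0 (R : realType) (A : R) (S : nat -> {poly R}) :
  monic_orthogonal (form2 A) S -> S 0%N = 1.
Proof.
move=> [/(_ 0%N)[/monicP + s0] _]; rewrite lead_coefE s0 /= => c.
by rewrite (size1_polyC (eq_leq s0)) c.
Qed.

Lemma orthogonal_S1 (R : realType) (A : R) (S : nat -> {poly R}) :
  monic_orthogonal (form2 A) S -> S 1%N = 'X.
Proof.
move=> hS; have S0 := orthogonal_S0 hS.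
have [hS' _] := hS; have [/monicP + s1] := hS' 1%N; rewrite lead_coefE s1/= => c1.
have e : S 1%N = 1 *: 'X + ((S 1%N)`_0 *: 1 + 0).
  rewrite -[LHS](coefK (S 1%N)) s1 poly_def !big_ord_recl big_ord0 /=.
  by rewrite c1 expr0 expr1 !addr0 addrC.
have : form2 A (S 1%N) 1 = 0 by apply: (orthogonal_lower hS); rewrite size_poly1.
rewrite e !form2_linear form2_11 (form2C _ 'X) form2_1X.
rewrite form2_0l mulr0 add0r addr0 => /eqP; rewrite mulf_eq0 oppr_eq0 mulf_eq0 pnatr_eq0/=.
rewrite sqrtr_eq0 leNgt pi_gt0 orbF => /eqP ->.
by rewrite scale1r scale0r !addr0.
Qed.

(** Comparing coefficients of [H_n] gives [b_n], and those of [H_(n-2)] force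
    [a_n = lambda_n (n - 3/2 - lambda_n)] for [n >= 2]. For [n >= 4], [lambda_rec] turns this into
    the quotient form; at [n = 3] the bracket is [sqrt pi / (2 (sqrt pi + A))], whence the factor
    [lambda_3]. *)
Lemma five_term_corrected (R : realType) (A : R) (S : nat -> {poly R}) :
  monic_orthogonal (form2 A) S ->
  five_term_recurrence S (coef_b A (lambda (4 * A)))
    (coef_a (lambda (4 * A) 3 * (Num.sqrt pi / (2 * (Num.sqrt pi + A))))
       (lambda (4 * A))).
Proof.
move=> hS; have S0 : S 0%N = hermite R 0 := orthogonal_S0 hS.
have S1 : S 1%N = hermite R 1 := orthogonal_S1 hS.
have D0 m := gamma_comb_neq0 m hS.
have Sn n : S n.+2 = hermite R n.+2 + lambda (4 * A) n.+2 *: hermite R n.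
  by rewrite (hermite_connection_lambda hS)// !subSS subn0.
have l2 : lambda (4 * A) 2 = 1 by rewrite -[2%N]/(1.*2) lambda_even.
have s0 : Num.sqrt pi != 0 :> R by rewrite gt_eqF// sqrtr_gt0 pi_gt0.
have pis : pi = Num.sqrt pi ^+ 2 :> R by rewrite sqr_sqrtr// pi_ge0.
have g0 : gamma_comb (4 * A) 0 = 2 * Num.sqrt pi * (Num.sqrt pi + A).
  by rewrite gamma_comb0 [X in 2 * X]pis; field.
have g1 : gamma_comb (4 * A) 1 = Num.sqrt pi * (2 * Num.sqrt pi + 3 * A).
  by rewrite gamma_comb1 [X in 2 * X]pis; field.
have sA : Num.sqrt pi + A != 0.
  by apply: contraNneq (D0 0%N) => h; rewrite g0 h mulr0.
have l3 : lambda (4 * A) 3 = (2 * Num.sqrt pi + 3 * A) / (2 * (Num.sqrt pi + A)).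
  rewrite (lambda_odd _ 0 : lambda (4 * A) 3 = _) g0 g1.
  by field; rewrite s0 sA.
have l4 n := lambda_rec n D0.
have l0 n := lambda_neq0 n D0.
have X2S n : 'X^2 * S n.+2 = 'X^2 * hermite R n.+2
    + lambda (4 * A) n.+2 *: ('X^2 * hermite R n).
  by rewrite Sn mulrDr scalerAr.
have ext n : extend0 S (n.+2%:Z - 2) = S n.
  by rewrite -[n.+2]addn2 PoszD addrK.
split=> //; case=> [|[|[|[|n]]]].
- rewrite scale0r addr0 Sn l2 S0 mulX2_hermite /coef_b.
  move: (hermite R 2) (hermite R 0) => h2 h0.
  by apply/polyP => i; rewrite !coefE; field.
- rewrite scale0r addr0 Sn l3 S1 mulX2_hermite /coef_b.
  move: (hermite R 3) (hermite R 1) => h3 h1.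
  by apply/polyP => i; rewrite !coefE; field.
- rewrite ext S0 X2S !mulX2_hermite !Sn (l4 0%N) /coef_b /coef_a l2.
  rewrite -[(2 - 2)%N]/0%N -[(2 * (2 - 1))%N]/2%N.
  move: (hermite R 4) (hermite R 2) (hermite R 0) => h4 h2 h0.
  by apply/polyP => i; rewrite !coefE; field.
(* [b_3] divides by [lambda_3], so the numerator of [lambda_3] must be nonzero. *)
- have z0 := l0 1%N; have sA3 : 2 * Num.sqrt pi + 3 * A != 0.
    by apply: contraNneq z0 => h; rewrite l3 h mul0r.
  rewrite ext S1 X2S !mulX2_hermite !Sn (l4 1%N) /coef_b /coef_a l3.
  rewrite -[(3 - 2)%N]/1%N -[(3 * (3 - 1))%N]/6%N.
  move: (hermite R 5) (hermite R 3) (hermite R 1) => h5 h3 h1.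
  by apply/polyP => i; rewrite !coefE; field; rewrite sA sA3.
set z := lambda (4 * A) n.+4; set y := lambda (4 * A) n.+2.
have y0 : y != 0 := l0 n; have z0 : z != 0 := l0 n.+2.
have bE : coef_b A (lambda (4 * A)) n.+4 =
    z + (n%:R + 4) * (n%:R + 3) / (4 * z).
  by rewrite /coef_b subSS subn0 natrM -/z -(natr1 n.+3) -(natr1 n.+2) -(natr1 n.+1)
    -(natr1 n); field.
have aE a3 : coef_a a3 (lambda (4 * A)) n.+4 *: S n.+2 =
    (z * (n%:R + 5 / 2 - z)) *: hermite R n.+2 +
    (z * ((n%:R + 2) * (n%:R + 1) / 4)) *: hermite R n.
  rewrite Sn scalerDr scalerA /coef_a !subSS !subn0 -/z -/y natrM.
  rewrite -(natr1 n.+1) -(natr1 n).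
  congr (_ *: _ + _ *: _); last by field.
  by rewrite [z in _ - z]l4 -/y; field.
rewrite ext aE bE X2S !mulX2_hermite !Sn (l4 n.+2) -/z.
rewrite !subSS !subn0 -(natr1 n.+3) -(natr1 n.+2) -(natr1 n.+1) -(natr1 n).
by apply/polyP => i; rewrite !coefE; field.
Qed.

Lemma lambda_eq_mass0 (R : realType) (A : R) :
  lambda A 3 = lambda (4 * A) 3 -> gamma_comb (4 * A) 0 != 0 ->
  gamma_comb (4 * A) 1 != 0 -> A = 0.
Proof.
rewrite (lambda_odd _ 0 : lambda A 3 = _) (lambda_odd _ 0 : lambda (4 * A) 3 = _).
have s0 : 0 < Num.sqrt pi :> R by rewrite sqrtr_gt0 pi_gt0.
have p0 := pi_gt0 R.
(* If this denominator vanishes, [lambda A 3] is 0 by convention, whereas [lambda (4 * A) 3] is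
   not. *)
move=> e D0 D1; have [g0|g0] := eqVneq (gamma_comb A 0) 0.
  move: e; rewrite g0 invr0 mulr0 => /esym/eqP.
  by rewrite mulf_eq0 invr_eq0 (negPf D0) (negPf D1).
move: e => /eqP; rewrite eqr_div//.
rewrite !gamma_comb0 !gamma_comb1 -subr_eq0.
(* After cross-multiplication the constant and quadratic terms in [A] cancel. *)
have -> : (2 * pi + 3 / 4 * Num.sqrt pi * A) * (2 * pi + Num.sqrt pi / 2 * (4 * A))
    - (2 * pi + 3 / 4 * Num.sqrt pi * (4 * A)) * (2 * pi + Num.sqrt pi / 2 * A)
    = - (3 / 2) * pi * Num.sqrt pi * A by field.
by rewrite !mulf_eq0 oppr_eq0 !mulf_eq0 invr_eq0 !pnatr_eq0/= (gt_eqF p0)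
  (gt_eqF s0)/= => /eqP.
Qed.

(* The first conjunct is the theorem with the two constants that are
   inconsistent with [form2] repaired: the mass in lambda (4 * A for A) and a_3
   (a missing factor lambda_3).  The second is the recurrence with the constants
   as originally printed, under the originally printed connection formula. *)
Theorem theorem2p26 (R : realType) (A : R) (S : nat -> {poly R})
    (hS : monic_orthogonal (form2 A) S) :
  (hermite_connection S (lambda (4 * A)) /\
   five_term_recurrence S
     (coef_b A (lambda (4 * A)))
     (coef_a (lambda (4 * A) 3 * (Num.sqrt pi / (2 * (Num.sqrt pi + A))))
             (lambda (4 * A)))) /\
  (hermite_connection S (lambda A) ->
   five_term_recurrence S
     (coef_b A (lambda A))
     (coef_a (Num.sqrt pi / (2 * (Num.sqrt pi + A))) (lambda A))).
Proof.
have conn := hermite_connection_lambda hS; have rec := five_term_corrected hS.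
split=> // conn'.
have D0 m := gamma_comb_neq0 m hS.
have e : lambda A 3 = lambda (4 * A) 3.
  have := conn' 3%N isT; rewrite conn// => /addrI/eqP.
  rewrite -subr_eq0 -scalerBl scaler_eq0 polyX_eq0 orbF subr_eq0.
  by rewrite eq_sym => /eqP.
(* [lambda _ 3] is a Moebius function of the mass, hence injective, so A = 4A. *)
have A0 := lambda_eq_mass0 e (D0 0%N) (D0 1%N).
(* At [A = 0] one has [lambda_3 = 1], so the two values of [a_3] coincide. *)
have -> : Num.sqrt pi / (2 * (Num.sqrt pi + A)) =
    lambda (4 * A) 3 * (Num.sqrt pi / (2 * (Num.sqrt pi + A))).
  rewrite -e A0 (lambda_odd _ 0 : lambda 0 3 = _) gamma_comb0 gamma_comb1 !mulr0 !addr0.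
  by rewrite divff ?mul1r// mulf_neq0// gt_eqF// pi_gt0.
by move: rec; rewrite (_ : 4 * A = A)// A0 mulr0.
Qed.
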